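(* Let $q\ge1$, let $a_k,b_k$ be real with $b_k>a_k>1$ for $k=1,\dots,q$, and let $0<\sigma\le1$. Then for all $x>0$, $$ {}_{q+1}F_q(\sigma,a_1,\dots,a_q;b_1,\dots,b_q;-x)<\frac{1}{\left(1+x\prod_{i=1}^q\frac{a_i-1}{b_i-1}\right)^{\sigma}}. $$
   Context: ${}_{q+1}F_q(\alpha_1,\dots,\alpha_{q+1};\beta_1,\dots,\beta_q;z)=\sum_{n\ge0}\frac{(\alpha_1)_n\cdots(\alpha_{q+1})_n}{(\beta_1)_n\cdots(\beta_q)_n n!}z^n$ with $(a)_n=a(a+1)\cdots(a+n-1)$, analytically continued to $\mathbb C\setminus[1,\infty)$. *)

(* Defs.v *)
From HB Require Import structures.
From mathcomp Require Import all_boot all_order all_algebra.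
From mathcomp Require Import all_classical all_reals all_analysis.
Set Implicit Arguments. Unset Strict Implicit. Unset Printing Implicit Defensive.
Import Order.TTheory GRing.Theory Num.Theory.
Import numFieldNormedType.Exports.
Local Open Scope classical_set_scope.
Local Open Scope ring_scope.

Definition poch {R : realType} (a : R) (n : nat) : R :=
  \prod_(i < n) (a + i%:R).

Definition hyp_coef {R : realType} (q : nat) (s : R) (a b : 'I_q -> R)
  (n : nat) : R :=
  poch s n * (\prod_(i < q) poch (a i) n)
  / ((\prod_(i < q) poch (b i) n) * n`!%:R).

Definition real_analytic_on {R : realType} (D : set R) (F : R -> R) : Prop :=
  forall y, D y -> exists r : R, 0 < r /\ exists c : nat -> R,
    forall t, `|t - y| < r ->
      (fun N => \sum_(k < N) c k * (t - y) ^+ k) @ \oo --> F t.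

(* F is the (restriction to the real ray (-oo,1) of the) analytic
   continuation of the hypergeometric series: real-analytic on (-oo,1)
   and equal to the series on (-1,1). Such F exists and is unique. *)
Definition hyp_continuation {R : realType} (q : nat) (s : R)
  (a b : 'I_q -> R) (F : R -> R) : Prop :=
  real_analytic_on [set t | t < 1] F /\
  forall t : R, `|t| < 1 ->
    (fun N => \sum_(k < N) hyp_coef s a b k * t ^+ k) @ \oo --> F t.

(* Main.v *)
Require Import Defs.
From HB Require Import structures.
From mathcomp Require Import all_boot all_order all_algebra.
From mathcomp Require Import all_classical all_reals all_analysis.
From mathcomp Require Import ring lra.
Import Order.TTheory GRing.Theory Num.Theory.
Import numFieldNormedType.Exports.
Local Open Scope ring_scope.

(** Let L be a positive normalized functional on the bounded functions on
    [0,1] whose moments are those of the product of independent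
    Beta(a_i - 1, b_i - a_i) variables, and let m = L(t) be the product of
    the (a_i - 1)/(b_i - 1).  Since (a - 1)_{n+1} = (a - 1) (a)_n, the
    binomial series gives L(t (1 - z t)^-s) = m F(z) for |z| < 1; both sides
    are analytic on (-oo,0], so the identity holds at z = -x as well.  For
    0 < s <= 1 the function t (1 + x t)^-s is uniformly concave on [0,1], and
    Jensen's inequality, with a quadratic defect that is strict because
    L(t^2) > m^2, bounds m F(-x) by m (1 + x m)^-s.

    Integration against a Beta law is replaced by an ultrafilter limit of
    expectations under Polya's urn. *)

(** * Rising factorials *)

Lemma poch0 {R : realType} (a : R) : poch a 0 = 1.
Proof. by rewrite /poch big_ord0. Qed.

Lemma pochS {R : realType} (a : R) n : poch a n.+1 = poch a n * (a + n%:R).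
Proof. by rewrite /poch big_ord_recr. Qed.

Lemma pochSl {R : realType} (a : R) n : poch a n.+1 = a * poch (a + 1) n.
Proof.
rewrite /poch big_ord_recl addr0; congr (_ * _); apply: eq_bigr => i _.
by rewrite lift0 -addrA -natr1 [1 + _]addrC.
Qed.

Lemma poch_gt0 {R : realType} (a : R) n : 0 < a -> 0 < poch a n.
Proof. by move=> a0; apply: prodr_gt0 => i _; rewrite ltr_wpDr. Qed.

Lemma poch_shift {R : realType} (a : R) n :
  a * poch (a + 1) n = poch a n * (a + n%:R).
Proof. by rewrite -pochSl pochS. Qed.

(** * Polya's urn and its moments *)

(* Polya's urn with initial weights a and b - a: urn a b N f is the expectation
   of f(K_N), K_N being the number of successes in the first N draws.  The
   recursion conditions on the last draw. *)
Fixpoint urn {R : realType} (a b : R) (N : nat) (f : nat -> R) : R :=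
  if N is M.+1 then
    urn a b M (fun k => ((a + k%:R) * f k.+1 + (b - a + M%:R - k%:R) * f k)
                        / (b + M%:R))
  else f 0.

Lemma urn_lin {R : realType} (a b : R) N c (f g : nat -> R) :
  urn a b N (fun k => c * f k + g k) = c * urn a b N f + urn a b N g.
Proof.
elim: N f g => //= N IH f g; rewrite -IH; congr urn.
by apply/funext => k; ring.
Qed.

Lemma urn_le {R : realType} (a b : R) N (f g : nat -> R) :
  0 < a -> a < b -> (forall k, (k <= N)%N -> f k <= g k) ->
  urn a b N f <= urn a b N g.
Proof.
move=> a0 ab; elim: N f g => [|N IH] f g fg /=; first exact: fg.
apply: IH => k kN; apply: ler_wpM2r.
  by rewrite invr_ge0 addr_ge0// ltW// (lt_trans a0).
apply: lerD; apply: ler_wpM2l; rewrite ?fg ?(leqW kN)//.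
  by rewrite addr_ge0 // ltW.
have : k%:R <= N%:R :> R by rewrite ler_nat.
lra.
Qed.

Lemma urn_cst {R : realType} (a b : R) N c : 0 < b -> urn a b N (fun=> c) = c.
Proof.
move=> b0; elim: N => //= N IH; rewrite -[RHS]IH; congr urn; apply/funext => k.
by field; rewrite gt_eqF // ltr_wpDr.
Qed.

(* (a + K_N)_n is, up to the factor (b + N)_n, a martingale. *)
Lemma urn_poch {R : realType} (a b : R) N n : 0 < b ->
  urn a b N (fun k => poch (a + k%:R) n)
  = poch a n * poch (b + N%:R) n / poch b n.
Proof.
move=> b0; have pb M : b + M%:R != 0 by rewrite gt_eqF // ltr_wpDr.
elim: N => [|N IH] /=.
  by rewrite !addr0 mulfK // gt_eqF // poch_gt0.
transitivity (urn a b N (fun k => ((b + N%:R + n%:R) / (b + N%:R)) *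
    poch (a + k%:R) n + 0)).
  congr urn; apply/funext => k; rewrite addr0.
  have -> : a + k.+1%:R = a + k%:R + 1 by rewrite -natr1 addrA.
  by rewrite poch_shift; field; exact: pb.
rewrite (urn_lin _ _ _ _ (fun k => poch (a + k%:R) n) (fun=> 0)) IH.
rewrite urn_cst //.
have := poch_shift (b + N%:R) n; rewrite -addrA natr1 => e.
have p0 : poch b n != 0 by rewrite gt_eqF // poch_gt0.
have -> : poch (b + N.+1%:R) n = poch (b + N%:R) n * (b + N%:R + n%:R) / (b + N%:R).
  by rewrite -e mulrAC mulfV // mul1r.
by field; rewrite p0 pb.
Qed.

(** The ratio [poch (a + k) n / poch (b + N) n] has expectation exactly [poch a n / poch b n] by
    [urn_poch]. It is a product of factors [(a + k + i) / (b + N + i)], each at most 1 and exceeding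
    [(a + k) / (b + N)] by at most [i / (b + N)], so it is uniformly close to the [n]-th power. *)
Lemma urn_moment_bound {R : realType} (a b : R) N n : 0 < a -> a < b ->
  `|urn a b N (fun k => ((a + k%:R) / (b + N%:R)) ^+ n) - poch a n / poch b n|
  <= (n ^ 2)%:R / (b + N%:R).
Proof.
move=> a0 ab; have b0 : 0 < b by exact: lt_trans ab.
have bN : 0 < b + N%:R by rewrite ltr_wpDr.
have pN : 0 < poch (b + N%:R) n by exact: poch_gt0.
pose e := (n ^ 2)%:R / (b + N%:R).
have key k : (k <= N)%N ->
    0 <= poch (a + k%:R) n / poch (b + N%:R) n - ((a + k%:R) / (b + N%:R)) ^+ n
      <= e.
  move=> kN; have kN' : k%:R <= N%:R :> R by rewrite ler_nat.
  have kR : 0 <= k%:R :> R by [].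
  set y := (a + k%:R) / (b + N%:R).
  have y0 : 0 <= y by apply: divr_ge0; lra.
  have y1 : y <= 1 by rewrite ler_pdivrMr //; lra.
  rewrite /e {e pN}; elim: n => [|n]; first by rewrite !poch0 divr1 subrr mul0r lexx.
  have nR : 0 <= n%:R :> R by [].
  have pN : 0 < poch (b + N%:R) n by exact: poch_gt0.
  set x := (a + k%:R + n%:R) / (b + N%:R + n%:R).
  have -> : poch (a + k%:R) n.+1 / poch (b + N%:R) n.+1
      = poch (a + k%:R) n / poch (b + N%:R) n * x.
    by rewrite !pochS invfM mulrACA.
  set p := poch _ _ / _.
  have x1 : x <= 1 by rewrite ler_pdivrMr; lra.
  have x0 : 0 <= x by apply: divr_ge0; lra.
  have yx : y <= x.
    by rewrite /y /x ler_pdivrMr // mulrAC ler_pdivlMr; nra.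
  have xy : x <= y + n%:R / (b + N%:R).
    rewrite /x /y -mulrDl ler_wpM2l //; first lra.
    by rewrite lef_pV2 ?posrE; lra.
  have yn0 : 0 <= y ^+ n by exact: exprn_ge0.
  have yn1 : y ^+ n <= 1 by exact: exprn_ile1.
  rewrite exprSr => /andP[h0 h1].
  (* The first summand is the induction hypothesis, the second bounds [x - y], and the third is
     slack that keeps the bound a perfect square. *)
  have -> : (n.+1 ^ 2)%:R / (b + N%:R) = (n ^ 2)%:R / (b + N%:R) + n%:R / (b + N%:R) + n.+1%:R / (b + N%:R).
    by rewrite -!mulrDl -!natrD; congr (_%:R / _); rewrite !expnS !expn0; ring.
  have n1 : 0 <= n.+1%:R / (b + N%:R) by apply: divr_ge0 => //; exact: ltW.
  have n2 : 0 <= n%:R / (b + N%:R) by apply: divr_ge0 => //; exact: ltW.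
  apply/andP; split; nra.
have m : urn a b N (fun k => (poch (b + N%:R) n)^-1 * poch (a + k%:R) n + 0)
    = poch a n / poch b n.
  rewrite (urn_lin _ _ _ _ (fun k => poch (a + k%:R) n) (fun=> 0)) urn_poch //.
  rewrite urn_cst //; field; by rewrite !gt_eqF // poch_gt0.
have le1 : urn a b N (fun k => ((a + k%:R) / (b + N%:R)) ^+ n) <= poch a n / poch b n.
  rewrite -m; apply: urn_le => // k /key /andP[+ _].
  by rewrite subr_ge0 addr0 [_^-1 * _]mulrC.
have le2 : poch a n / poch b n
    <= 1 * urn a b N (fun k => ((a + k%:R) / (b + N%:R)) ^+ n) + e.
  rewrite -m -(urn_cst a b N e b0) -urn_lin.
  apply: urn_le => // k /key /andP[_ +].
  by rewrite lerBlDr addr0 mul1r [_^-1 * _]mulrC [X in _ <= X]addrC.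
rewrite mul1r in le2; rewrite -/e ler_norml; apply/andP; split; lra.
Qed.

(** * Positive normalized functionals on [0,1] *)

Definition bdd {R : realType} (f : R -> R) : Prop :=
  exists M, forall t, 0 <= t <= 1 -> `|f t| <= M.

Lemma bdd_cst {R : realType} (c : R) : bdd (fun=> c).
Proof. by exists `|c|. Qed.

Lemma bdd_unit {R : realType} (f : R -> R) :
  (forall t, 0 <= t <= 1 -> 0 <= f t <= 1) -> bdd f.
Proof.
by move=> f01; exists 1 => t /f01/andP[f0 f1]; rewrite ger0_norm.
Qed.

Lemma bddD {R : realType} (f g : R -> R) :
  bdd f -> bdd g -> bdd (fun t => f t + g t).
Proof.
move=> [M fM] [K gK]; exists (M + K) => t t01.
by rewrite (le_trans (ler_normD _ _)) // lerD ?fM ?gK.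
Qed.

Lemma bddM {R : realType} (f g : R -> R) :
  bdd f -> bdd g -> bdd (fun t => f t * g t).
Proof.
move=> [M fM] [K gK]; exists (M * K) => t t01.
by rewrite normrM ler_pM ?fM ?gK.
Qed.

Lemma bddX {R : realType} n : bdd (fun t : R => t ^+ n).
Proof.
by apply: bdd_unit => t /andP[t0 t1]; rewrite exprn_ge0 // exprn_ile1.
Qed.

(* Expectations on [0,1]: only the values on [0,1] matter, and nothing is
   required of L on unbounded functions. *)
Record state {R : realType} (L : (R -> R) -> R) : Prop := State {
  state_lin : forall c f g, bdd f -> bdd g ->
    L (fun t => c * f t + g t) = c * L f + L g;
  state_le : forall f g, bdd f -> bdd g ->
    (forall t, 0 <= t <= 1 -> f t <= g t) -> L f <= L g;
  state_cst : forall c, L (fun=> c) = c }.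

Lemma state_eq {R : realType} (L : (R -> R) -> R) (f g : R -> R) :
  state L -> bdd f -> bdd g -> (forall t, 0 <= t <= 1 -> f t = g t) ->
  L f = L g.
Proof.
move=> sL bf bg fg; apply/eqP.
by rewrite eq_le !(state_le _ sL) // => t /fg ->.
Qed.

Lemma stateZ {R : realType} (L : (R -> R) -> R) c (f : R -> R) :
  state L -> bdd f -> L (fun t => c * f t) = c * L f.
Proof.
move=> sL bf; rewrite -[RHS]addr0 -(state_cst _ sL 0) -state_lin //; last first.
  exact: bdd_cst.
by congr L; apply/funext => t; rewrite addr0.
Qed.

Lemma state_bound {R : realType} (L : (R -> R) -> R) (f : R -> R) M :
  state L -> (forall t, 0 <= t <= 1 -> `|f t| <= M) -> `|L f| <= M.
Proof.
move=> sL fM; have bf : bdd f by exists M.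
rewrite ler_norml -{1}(state_cst _ sL (- M)) -{2}(state_cst _ sL M).
apply/andP; split; apply: state_le => //; try exact: bdd_cst;
  by move=> t /fM; rewrite ler_norml => /andP[].
Qed.

(** * Functionals for Beta laws and for products of independent Beta variables *)

(** Compactness of [[- M, M]] gives a cluster point, and a cluster point of an ultrafilter is a
    limit, since each set or its complement belongs to the ultrafilter. *)
Lemma ultra_cvg {R : realType} (U : set_system nat) (u : nat -> R) M :
  UltraFilter U -> (forall N, `|u N| <= M) -> exists l : R, (u @ U --> l)%classic.
Proof.
move=> UU uM.
have [] := @segment_compact R (- M) M (u @ U)%classic.
  suff : U (u @^-1` `[- M, M])%classic by [].
  by apply: filterE => N; rewrite /= in_itv /= -ler_norml.
move=> l [_ cl]; exists l => A nA.
case: (in_ultra_setVsetC (u @^-1` A)%classic UU) => // UA.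
by case: (cl (~` A)%classic A UA nA) => x [].
Qed.

(** The success fraction of the urn tends in law to Beta(a, b - a). The limit along an ultrafilter
    gives a value to every bounded [f], measurable or not, and passes linearity and monotonicity on
    from the urn. *)
Lemma beta_state {R : realType} (a b : R) : 0 < a -> a < b ->
  exists2 L : (R -> R) -> R, state L &
    forall n, L (fun t => t ^+ n) = poch a n / poch b n.
Proof.
move=> a0 ab; have b0 : 0 < b by exact: lt_trans ab.
have [U [UU oU]] := ultraFilterLemma (eventually_filter).
pose u f N := urn a b N (fun k => f ((a + k%:R) / (b + N%:R))).
have node k N : (k <= N)%N -> 0 <= (a + k%:R) / (b + N%:R) <= 1.
  move=> kN; have kN' : k%:R <= N%:R :> R by rewrite ler_nat.
  have kR : 0 <= k%:R :> R by [].
  by rewrite divr_ge0 /= ?ler_pdivrMr; lra.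
have u_le f g N : (forall t, 0 <= t <= 1 -> f t <= g t) -> u f N <= u g N.
  by move=> fg; apply: urn_le => // k kN; apply/fg/node.
have u_cst c N : u (fun=> c) N = c by exact: urn_cst.
have ucvg f : bdd f -> (u f @ U --> lim (u f @ U))%classic.
  move=> [M fM]; have [|l ul] := @ultra_cvg _ U (u f) M UU.
    move=> N; rewrite ler_norml -{1}(u_cst (- M) N) -{2}(u_cst M N).
    by rewrite !u_le // => t /fM; rewrite ler_norml => /andP[].
  by apply/cvg_ex; exists l.
have uP f (l : R) : (u f @ U --> l)%classic -> lim (u f @ U)%classic = l.
  exact: cvg_lim.
exists (fun f => lim (u f @ U))%classic; first split.
- move=> c f g bf bg; apply: uP.
  have -> : u (fun t => c * f t + g t) = (fun N => c * u f N + u g N).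
    by apply/funext => N; rewrite /u -urn_lin.
  by apply: cvgD; [apply: cvgMl_tmp|]; exact: ucvg.
- move=> f g bf bg fg; apply: (ler_cvg_to (ucvg _ bf) (ucvg _ bg)).
  by apply: filterE => N; exact: u_le.
- move=> c; apply: uP; have -> : u (fun=> c) = fun=> c by apply/funext.
  exact: cvg_cst.
(* [U] refines [\oo], so on powers the ordinary limit supplied by [urn_moment_bound] suffices. *)
move=> n; apply: uP; apply: cvg_trans (cvg_app _ oU) _.
apply: cvg_zero; apply: norm_cvg0.
apply: (@squeeze_cvgr _ _ _ _ (fun=> 0) (fun N => (n ^ 2)%:R / N%:R)).
- near=> N; rewrite normr_ge0 /=; apply: (le_trans (urn_moment_bound _ _ _ _ a0 ab)).
  have N0 : 0 < N%:R :> R by rewrite ltr0n; near: N; exact: nbhs_infty_gt.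
  by rewrite ler_wpM2l // lef_pV2 ?posrE //; lra.
- exact: cvg_cst.
- rewrite -(mulr0 (n ^ 2)%:R); apply: cvgMl_tmp.
  apply/gtr0_cvgV0; last exact: cvgr_idn.
  by near=> N; rewrite ltr0n; near: N; exact: nbhs_infty_gt.
Unshelve. all: by end_near.
Qed.

(** Independence is expressed by nesting: [f] is sent to [L1 (t => L2 (u => f (t * u)))], and
    moments multiply because [(t * u) ^+ n] factors. *)
Lemma product_state {R : realType} q (a b : 'I_q -> R) :
  (forall i, 0 < a i /\ a i < b i) ->
  exists2 L : (R -> R) -> R, state L &
    forall n, L (fun t => t ^+ n) = \prod_(i < q) (poch (a i) n / poch (b i) n).
Proof.
elim: q a b => [|q IH] a b ab.
  (* The empty product is the constant variable 1, whose law is the point mass at 1. *)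
  exists (fun f => f 1); first by split => // f g _ _; apply; rewrite ler01 lexx.
  by move=> n; rewrite big_ord0 expr1n.
have [L1 s1 m1] := IH _ _ (fun i => ab (widen_ord (leqnSn q) i)).
have [a0 ab0] := ab ord_max.
have [L2 s2 m2] := beta_state _ _ a0 ab0.
have bsc f t : bdd f -> 0 <= t <= 1 -> bdd (fun u => f (t * u)).
  move=> [M fM] /andP[t0 t1]; exists M => u /andP[u0 u1]; apply: fM.
  by rewrite mulr_ge0 //= mulr_ile1.
have bL f : bdd f -> bdd (fun t => L2 (fun u => f (t * u))).
  move=> [M fM]; exists M => t /andP[t0 t1]; apply: state_bound => // u /andP[u0 u1].
  by apply: fM; rewrite mulr_ge0 //= mulr_ile1.
exists (fun f => L1 (fun t => L2 (fun u => f (t * u)))); first split.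
- move=> c f g bf bg; rewrite -state_lin //; [|exact: bL..].
  apply: (state_eq _ _ _ s1).
  + by apply: (bL (fun t => c * f t + g t)); apply: bddD => //; apply: bddM => //; exact: bdd_cst.
  + by apply: bddD; [apply: bddM; [exact: bdd_cst|]|]; exact: bL.
  + by move=> t t01; rewrite -state_lin //; exact: bsc.
- move=> f g bf bg fg; apply: state_le => //; [exact: bL..|].
  move=> t t01; apply: state_le => //; [exact: bsc..|].
  move=> u /andP[u0 u1]; apply: fg; case/andP: t01 => t0 t1.
  by rewrite mulr_ge0 //= mulr_ile1.
- move=> c; rewrite (_ : (fun t => _) = fun=> c) ?(state_cst _ s1) //.
  by apply/funext => t; rewrite (state_cst _ s2).
move=> n; rewrite big_ord_recr /= -m1 -m2 [RHS]mulrC -stateZ //; last exact: bddX.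
congr L1; apply/funext => t; rewrite [RHS]mulrC -stateZ //; last exact: bddX.
by congr L2; apply/funext => u; rewrite exprMn.
Qed.

(** * Estimates for real powers *)

Lemma powRN_le {R : realType} (d x r : R) :
  0 < d -> d <= 1 -> d <= x -> 0 <= r <= 1 -> x `^ (- r) <= d^-1.
Proof.
move=> d0 d1 dx /andP[r0 r1]; have x0 : 0 < x by exact: lt_le_trans dx.
rewrite powRN lef_pV2 ?posrE ?powR_gt0 //.
have h1 : d `^ r <= x `^ r by apply: ge0_ler_powR; rewrite ?nnegrE // ltW.
apply: le_trans h1; rewrite -{1}(powRr1 (ltW d0)).
by apply: ger_powR => //; rewrite d0.
Qed.

(* Weighted AM-GM, obtained by adding up the tangent bounds of expR at
   - s ln r. *)
Lemma powRN_tangent {R : realType} (r s : R) :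
  0 < r -> 0 <= s <= 1 -> r `^ (- s) <= s / r + (1 - s).
Proof.
move=> r0 /andP[s0 s1]; set l := ln r.
have rE : r = expR l by rewrite /l lnK.
have -> : r `^ (- s) = expR (- s * l) by rewrite /powR gt_eqF.
rewrite rE -expRN; set A := expR (- s * l).
have A0 : 0 < A by exact: expR_gt0.
have e1 : expR (- l) = A * expR (- l + s * l).
  by rewrite -expRD; congr expR; ring.
have e2 : 1 = A * expR (s * l).
  by rewrite -expRD -expR0; congr expR; ring.
have h1 : A * (1 + (- l + s * l)) <= expR (- l).
  by rewrite e1 ler_pM2l // expR_ge1Dx.
have h2 : A * (1 + s * l) <= 1 by rewrite [leRHS]e2 ler_pM2l // expR_ge1Dx.
have := lerD (ler_wpM2l s0 h1) (ler_wpM2l (_ : 0 <= 1 - s) h2).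
rewrite subr_ge0 => /(_ s1); rewrite mulr1; apply: le_trans.
by rewrite [leRHS](_ : _ = A) //; ring.
Qed.

(** * The binomial series with an explicit error *)

(** Taylor coefficients of [(1 - z)^-s] at 0. *)
Definition bcoef {R : realType} (s : R) k : R := poch s k / k`!%:R.

Lemma bcoefS {R : realType} (s : R) k :
  k.+1%:R * bcoef s k.+1 = (s + k%:R) * bcoef s k.
Proof.
rewrite /bcoef pochS factS natrM; field.
by rewrite nat1r !pnatr_eq0 -lt0n fact_gt0.
Qed.

Lemma bcoef_le1 {R : realType} (s : R) k : 0 < s <= 1 -> 0 <= bcoef s k <= 1.
Proof.
move=> /andP[s0 s1]; elim: k => [|k /andP[IH0 IH1]].
  by rewrite /bcoef poch0 divr1 ler01 lexx.
have k0 : 0 <= k%:R :> R by [].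
apply/andP; split; first by apply: divr_ge0 => //; exact/ltW/poch_gt0.
have kS : 0 < k.+1%:R :> R by rewrite ltr0n.
rewrite -(ler_pM2l kS) bcoefS mulr1 -natr1.
by apply: (le_trans (ler_wpM2l _ IH1)); lra.
Qed.

Definition bsum {R : realType} (s : R) N (z : R) : R :=
  \sum_(k < N) bcoef s k * z ^+ k.

Definition dbsum {R : realType} (s : R) N (z : R) : R :=
  \sum_(k < N) k%:R * bcoef s k * z ^+ k.-1.

Lemma is_derive_bsum {R : realType} (s : R) N (z : R) :
  is_derive z 1 (bsum s N) (dbsum s N z).
Proof.
pose p : {poly R} := \sum_(k < N) bcoef s k *: 'X^k.
have -> : bsum s N = horner p.
  apply/funext => x; rewrite /bsum horner_sum; apply: eq_bigr => k _.
  by rewrite !hornerE.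
apply: is_derive_eq; rewrite /p /dbsum raddf_sum horner_sum.
apply: eq_bigr => k _; rewrite -[LHS]/((bcoef s k *: 'X^k)^`()).[z].
by rewrite derivZ derivXn hornerZ hornerMn hornerXn mulrnAr -mulr_natl mulrA.
Qed.

(** The function [(1 - z)^-s] solves [(1 - z) y' = s y]. By [bcoefS] the contributions of
    consecutive terms telescope, so a partial sum solves this equation up to its top term. *)
Lemma dbsumE {R : realType} (s : R) N (z : R) :
  (1 - z) * dbsum s N z - s * bsum s N z = - (N%:R * bcoef s N * z ^+ N.-1).
Proof.
elim: N => [|N IH]; first by rewrite /dbsum /bsum !big_ord0; ring.
rewrite bcoefS /dbsum /bsum !big_ord_recr /= -/(dbsum s N z) -/(bsum s N z).
rewrite mulrDr (mulrDr s) opprD addrACA IH.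
case: N {IH} => [|N] /=; first by rewrite expr0; ring.
by rewrite exprS; ring.
Qed.

Lemma mean_value_bound {R : realType} (f df : R -> R) (y rho K : R) :
  `|y| <= rho -> (forall z : R, `|z| <= rho -> is_derive z 1 f (df z)) ->
  (forall z, `|z| <= rho -> `|df z| <= K) -> `|f y - f 0| <= K * rho.
Proof.
move=> yr fd fK.
have K0 : 0 <= K by apply: le_trans (fK _ yr).
have dc a b : - rho <= a -> b <= rho ->
    {within `[a, b], continuous f}%classic.
  move=> ar br; apply: derivable_within_continuous => z.
  rewrite in_itv /= => /andP[az zb].
  have /fd : `|z| <= rho by rewrite ler_norml; lra.
  by case.
have dd a b : - rho <= a -> b <= rho ->
    forall z : R, z \in `]a, b[ -> is_derive z 1 f (df z).
  move=> ar br z; rewrite in_itv /= => /andP[az zb].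
  by apply: fd; rewrite ler_norml; lra.
move: (yr); rewrite ler_norml => /andP[y1 y2].
have [y0|y0] := leP 0 y.
  have [||c] := @MVT_segment _ f df 0 y y0.
  - by apply: dd => //; lra.
  - by apply: dc => //; lra.
  rewrite in_itv /= => /andP[c0 cy] ->; rewrite subr0 normrM ler_pM //.
  by apply: fK; rewrite ler_norml; lra.
have [||c] := @MVT_segment _ f df y 0 (ltW y0).
- by apply: dd => //; lra.
- by apply: dc => //; lra.
rewrite in_itv /= => /andP[c0 cy] e; rewrite distrC e sub0r normrM normrN ler_pM //.
by apply: fK; rewrite ler_norml; lra.
Qed.

(** The bound depends on [y] only through [rho]; this uniformity later allows [L] to be applied to
    the series term by term. *)
Lemma bsum_bound {R : realType} (s y rho : R) N : 0 < s <= 1 ->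
  `|y| <= rho -> rho < 1 ->
  `|bsum s N.+1 y - (1 - y) `^ (- s)| <= N.+1%:R * rho ^+ N.+1 / (1 - rho) ^+ 2.
Proof.
move=> s01 yr r1; have /andP[s0 s1] := s01.
have r0 : 0 <= rho by exact: le_trans yr.
have pos z : `|z| <= rho -> 1 - rho <= 1 - z.
  by rewrite ler_norml => /andP[_ zr]; lra.
have inv z p : `|z| <= rho -> 0 <= p <= 1 -> (1 - z) `^ (- p) <= (1 - rho)^-1.
  by move=> zr p01; apply: powRN_le; rewrite ?pos //; lra.
(* h(0) = 1, and by dbsumE only the top coefficient survives in h'. *)
pose h z := bsum s N.+1 z * (1 - z) `^ s.
pose dh z := - ((1 - z) `^ (s - 1) * (N.+1%:R * bcoef s N.+1 * z ^+ N)).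
have hd (z : R) : `|z| <= rho -> is_derive z 1 h (dh z).
  move=> zr; have z1 : 0 < 1 - z by have := pos z zr; lra.
  have d1 : is_derive z 1 (fun x : R => (1 - x) `^ s) (s * (1 - z) `^ (s - 1) * (0 - 1)).
    apply: (@is_derive1_comp _ (fun x : R => x `^ s) (fun x => 1 - x)).
    exact: is_derive1_powR.
  apply: (is_derive_eq (is_deriveM (is_derive_bsum s N.+1 z) d1)).
  rewrite /GRing.scale /= /dh.
  have -> : (1 - z) `^ s = (1 - z) `^ (s - 1) * (1 - z).
    rewrite -{3}(powRr1 (ltW z1)) -powRD; first by congr powR; ring.
    by rewrite (gt_eqF z1) implybT.
  by rewrite -[_ ^+ N]/(z ^+ N.+1.-1) -[RHS]mulrN -dbsumE; ring.
have h0 : h 0 = 1.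
  rewrite /h subr0 powR1 mulr1 /bsum big_ord_recl big1 ?addr0.
    by rewrite /bcoef poch0 fact0 divr1 mulr1.
  by move=> i _; rewrite expr0n mulr0.
have := mean_value_bound h dh y rho ((1 - rho)^-1 * (N.+1%:R * rho ^+ N)) yr hd.
rewrite h0 => hh.
have bnd : `|h y - 1| <= (1 - rho)^-1 * (N.+1%:R * rho ^+ N) * rho.
  apply: hh => z zr; rewrite normrN normrM ler_pM //.
    rewrite ger0_norm ?powR_ge0 // -(opprB 1 s); apply: inv => //; lra.
  rewrite normrM ler_pM ?normr_ge0 //; last by rewrite normrX lerXn2r ?nnegrE.
  have /andP[c0 c1] := bcoef_le1 s N.+1 s01.
  by rewrite normrM normr_nat ger0_norm // -[leRHS]mulr1 ler_pM.
have y1 : 0 < 1 - y by have := pos y yr; lra.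
have e : bsum s N.+1 y - (1 - y) `^ (- s) = (h y - 1) * (1 - y) `^ (- s).
  by rewrite /h powRN; field; rewrite gt_eqF // powR_gt0.
rewrite e normrM.
have -> : N.+1%:R * rho ^+ N.+1 / (1 - rho) ^+ 2
   = (1 - rho)^-1 * (N.+1%:R * rho ^+ N) * rho * (1 - rho)^-1.
  by rewrite exprSr; field; rewrite gt_eqF // subr_gt0.
rewrite ler_pM // ger0_norm ?powR_ge0 //; apply: inv => //.
by rewrite ltW.
Qed.

Lemma cvg_nat_exprn {R : realType} (z : R) : 0 <= z < 1 ->
  ((fun N => N%:R * z ^+ N) @ \oo --> (0 : R))%classic.
Proof.
move=> /andP[z0 z1].
(* N t^N stays bounded for t = sqrt z, and z^N = t^N t^N. *)
pose t := Num.sqrt z.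
have t0 : 0 <= t by exact: sqrtr_ge0.
have t1 : t < 1 by rewrite -[ltRHS]sqrtr1 ltr_sqrt.
have bnd N : N%:R * t ^+ N * (1 - t) <= 1 - t ^+ N.
  elim: N => [|N IH]; first by rewrite mul0r mul0r expr0 subrr.
  have tN1 : t ^+ N <= 1 by rewrite exprn_ile1 // ltW.
  have tN0 : 0 <= t ^+ N by rewrite exprn_ge0.
  have h1 := ler_wpM2l t0 IH.
  have h2 : 0 <= (1 - t) * (1 - t * t ^+ N).
    by rewrite mulr_ge0 ?subr_ge0 ?mulr_ile1 // ltW.
  rewrite exprS -natr1; lra.
apply: (@squeeze_cvgr _ _ _ _ (fun=> 0) (fun N => (1 - t)^-1 * t ^+ N)).
- near=> N; rewrite mulr_ge0 ?exprn_ge0 //=.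
  rewrite -(sqr_sqrtr z0) -/t -exprM mulnC exprM expr2 mulrA.
  rewrite ler_wpM2r ?exprn_ge0 // -[_^-1]mul1r ler_pdivlMr ?subr_gt0 //.
  by apply: le_trans (bnd N) _; rewrite gerBl exprn_ge0.
- exact: cvg_cst.
- rewrite -(mulr0 (1 - t)^-1); apply: cvgMl_tmp; apply: cvg_expr.
  by rewrite ger0_norm.
Unshelve. all: by end_near.
Qed.

(** * The identity theorem for real-analytic functions *)

Lemma cvg_terms_bounded {R : realType} (v : nat -> R) (l : R) :
  ((fun N => \sum_(k < N) v k) @ \oo --> l)%classic ->
  exists M, forall k, `|v k| <= M.
Proof.
move=> vl; have vs : cvgn (series v).
  apply/cvg_ex; exists l; rewrite (_ : series v = fun N => \sum_(k < N) v k) //.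
  by apply/funext => N; rewrite /series /= big_mkord.
have := cvg_seq_bounded (cvgP _ (cvg_series_cvg_0 vs)).
move=> [M [_ hM]]; exists (M + 1) => k; apply: (hM (M + 1)) => //.
by rewrite ltrDl.
Qed.

(** Once the earlier coefficients vanish, the sum at [w * q] is [c k * (w * q) ^+ k] plus a tail of
    order [q ^+ k.+1]; dividing by [q ^+ k] and taking [q] small forces [c k = 0]. Only [u > 0] is
    assumed because [analytic_zero] knows the function on one side of the expansion point. *)
Lemma series_zero_coef {R : realType} (c : nat -> R) (r : R) : 0 < r ->
  (forall u, 0 < u < r ->
    ((fun N => \sum_(k < N) c k * u ^+ k) @ \oo --> (0 : R))%classic) ->
  forall k, c k = 0.
Proof.
move=> r0 hc; elim/ltn_ind => k IH.
have [w wr] : exists w, 0 < w < r.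
  by exists (r / 2); rewrite divr_gt0 //= ltr_pdivrMr // ltr_pMr // ltr1n.
have /andP[w0 _] := wr.
have [M hM] := cvg_terms_bounded (fun k => c k * w ^+ k) _ (hc w wr).
have M0 : 0 <= M by exact: le_trans (hM 0).
(* The factor [1 - q ^+ n] makes the induction close: for [q <= 1/2] its increment, times 2,
   dominates the new term [q ^+ n]. *)
have tail q n : 0 < q <= 2^-1 ->
    `|\sum_(j < k.+1 + n) c j * (w * q) ^+ j - c k * (w * q) ^+ k|
    <= 2 * M * q ^+ k.+1 * (1 - q ^+ n).
  move=> /andP[q0 q1]; elim: n => [|n IHn].
    rewrite addn0 big_ord_recr /= big1 ?add0r ?subrr ?normr0 ?expr0 ?mulr0 //.
    by move=> i _; rewrite IH ?mul0r.
  rewrite addnS big_ord_recr /= addrAC (le_trans (ler_normD _ _)) //.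
  have h : `|c (k.+1 + n) * (w * q) ^+ (k.+1 + n)| <= M * (q ^+ k.+1 * q ^+ n).
    rewrite -exprD exprMn mulrA normrM [X in _ * X]ger0_norm ?exprn_ge0 ?(ltW q0) //.
    by rewrite ler_wpM2r ?exprn_ge0 ?(ltW q0).
  apply: le_trans (lerD IHn h) _.
  have h2 : 0 <= M * (q ^+ k.+1 * q ^+ n) * (1 - 2 * q).
    rewrite !mulr_ge0 ?exprn_ge0 ?(ltW q0) //; lra.
  rewrite (exprS q n); lra.
have main q : 0 < q <= 2^-1 -> `|c k * w ^+ k| <= 2 * M * q.
  move=> q12; have /andP[q0 q1] := q12.
  have uq : 0 < w * q < r.
    rewrite mulr_gt0 //=; case/andP: wr => _; apply: le_lt_trans.
    by apply: ler_piMr; [exact: ltW|lra].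
  have /= := hc _ uq; rewrite -(cvg_shiftn k.+1) => lim0.
  have qk : 0 < q ^+ k by rewrite exprn_gt0.
  rewrite -(ler_pM2r qk).
  have -> : `|c k * w ^+ k| * q ^+ k = `|0 - c k * (w * q) ^+ k|.
    by rewrite -(ger0_norm (ltW qk)) -normrM sub0r normrN exprMn mulrA.
  have lim1 : ((fun n => `|\sum_(j < n + k.+1) c j * (w * q) ^+ j
      - c k * (w * q) ^+ k|) @ \oo --> `|0 - c k * (w * q) ^+ k|)%classic.
    by apply: cvg_norm; apply: cvgB; [exact: lim0|exact: cvg_cst].
  apply: (@ler_cvg_to _ \oo%classic _ R _ (fun=> 2 * M * q * q ^+ k) _ _ lim1).
    exact: cvg_cst.
  apply: nearW => n /=.
  rewrite addnC (le_trans (tail q n q12)) //.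
  rewrite -[leRHS]mulrA -exprS; apply: ler_piMr.
    by rewrite !mulr_ge0 // exprn_ge0 // ltW.
  by rewrite gerBl exprn_ge0 // ltW.
apply/eqP; apply: contraT => ck.
have A0 : 0 < `|c k * w ^+ k| by rewrite normr_gt0 mulf_neq0 // gt_eqF // exprn_gt0.
set A := `|_| in main A0.
(* With this choice [4 * (M + 1) * q <= A], which contradicts [A <= 2 * M * q] from [main]. *)
pose q := Num.min (2^-1) (A / (4 * (M + 1))).
have d0 : 0 < 4 * (M + 1) by lra.
have q0 : 0 < q by rewrite lt_min invr_gt0 ltr0n divr_gt0.
have qA : q * (4 * (M + 1)) <= A by rewrite -ler_pdivlMr // ge_min lexx orbT.
have /main : 0 < q <= 2^-1 by rewrite q0 ge_min lexx.
nra.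
Qed.

(** Let [p] be the infimum of the [t] such that [K] vanishes on [[t, 0]]. The expansion at [p]
    vanishes to the right of [p], so all its coefficients are 0 and [K] vanishes to the left of [p]
    as well, against the choice of [p]. *)
Lemma analytic_zero {R : realType} (K : R -> R) :
  real_analytic_on [set t | t <= 0]%classic K ->
  (forall t, `|t| < 1 -> K t = 0) -> forall t, t <= 0 -> K t = 0.
Proof.
move=> Ka K0 t0 t00; apply/eqP; apply: contraT => Kt0.
pose E : set R := [set t | t <= 0 /\ forall u, t <= u <= 0 -> K u = 0]%classic.
have Elb : lbound E t0.
  move=> t [_ Et]; rewrite leNgt; apply/negP => tt0.
  by move: Kt0; rewrite Et ?eqxx // (ltW tt0).
have hlb : has_lbound E by exists t0.
have E0 : E (- 2^-1).
  split; first by lra.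
  by move=> u /andP[u1 u2]; apply: K0; rewrite ltr_norml; lra.
pose p := inf E.
have pE : p <= - 2^-1 by exact: ge_inf.
have zero u : p < u <= 0 -> K u = 0.
  move=> /andP[pu u0]; have [||e [_ Ee] eu] := @inf_adherent _ E (u - p).
  - by rewrite subr_gt0.
  - by split => //; exists (- 2^-1).
  by apply: Ee; rewrite u0 andbT; move: eu; rewrite -/p; lra.
have [|r [r0 [c hc]]] := Ka p; first by rewrite /=; lra.
have c0 : forall k, c k = 0.
  (* Since [p <= - 1/2], capping the radius at 1/2 keeps [p + u] in the region [u <= 0] covered by
     [zero]. *)
  apply: (series_zero_coef c (Num.min r (2^-1))); first by rewrite lt_min r0 /=; lra.
  move=> u /andP[u0]; rewrite lt_min => /andP[ur u1].
  have := hc (p + u); rewrite (addrC p) addrK (gtr0_norm u0) => /(_ ur).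
  by rewrite zero //; apply/andP; lra.
have near t : `|t - p| < r -> K t = 0.
  move=> /hc; rewrite (_ : (fun N => _) = fun=> 0); last first.
    by apply/funext => N; rewrite big1 // => i _; rewrite c0 mul0r.
  by move=> /cvg_unique; apply => //; exact: cvg_cst.
have : p <= p - r / 2.
  apply: ge_inf => //; split; first by lra.
  move=> u /andP[u1 u2]; have [up|up] := leP u p; last by apply: zero; rewrite up.
  by apply: near; rewrite ltr_norml; lra.
lra.
Qed.

(** * Power series expansion of [L (u => u * (1 - t * u)^-s)] *)

Lemma state_sum {R : realType} (L : (R -> R) -> R) (al : nat -> R)
  (g : nat -> R -> R) N :
  state L -> (forall k, bdd (g k)) ->
  bdd (fun u => \sum_(k < N) al k * g k u) /\
  L (fun u => \sum_(k < N) al k * g k u) = \sum_(k < N) al k * L (g k).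
Proof.
move=> sL bg; elim: N => [|N [bN IH]].
  rewrite (_ : (fun u => _) = fun=> 0); last by apply/funext => u; rewrite big_ord0.
  by rewrite big_ord0 state_cst //; split => //; exact: bdd_cst.
rewrite (_ : (fun u => _) = fun u => al N * g N u + \sum_(k < N) al k * g k u).
  rewrite big_ord_recr /= state_lin // IH addrC; split => //.
  by apply: bddD => //; apply: bddM => //; exact: bdd_cst.
by apply/funext => u; rewrite big_ord_recr addrC.
Qed.

(* 1 - t u = (1 - y u) (1 - (t - y) v) with v = u / (1 - y u) in [0,1], so the
   binomial series in (t - y) v converges uniformly in u. *)
Lemma state_powR_expansion {R : realType} (L : (R -> R) -> R) (s y t : R) :
  state L -> 0 < s <= 1 -> y <= 0 -> `|t - y| < 1 ->
  ((fun N => \sum_(k < N) (bcoef s k *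
       L (fun u => u * (1 - y * u) `^ (- s) * (u / (1 - y * u)) ^+ k))
       * (t - y) ^+ k) @ \oo -->
   L (fun u => u * (1 - t * u) `^ (- s)))%classic.
Proof.
move=> sL s01 y0 ty; set rho := `|t - y|; have /andP[s0 s1] := s01.
pose v u := u / (1 - y * u).
pose g k u := u * (1 - y * u) `^ (- s) * v u ^+ k.
pose f u := u * (1 - t * u) `^ (- s).
have d1 u : 0 <= u <= 1 -> 1 <= 1 - y * u.
  by move=> /andP[u0 u1]; rewrite lerDl oppr_ge0 mulr_le0_ge0.
have v01 u : 0 <= u <= 1 -> 0 <= v u <= 1.
  move=> u01; have := d1 u u01; case/andP: u01 => u0 u1 d.
  rewrite /v divr_ge0 //=; last lra.
  by rewrite ler_pdivrMr; lra.
have p01 u : 0 <= u <= 1 -> 0 <= u * (1 - y * u) `^ (- s) <= 1.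
  move=> u01; rewrite mulr_ge0 ?powR_ge0 ?(andP u01).1 //=.
  rewrite mulr_ile1 ?powR_ge0 ?(andP u01).1 ?(andP u01).2 //.
  by rewrite -[leRHS]invr1; apply: powRN_le => //; [exact: d1|rewrite ltW].
have tvr u : 0 <= u <= 1 -> `|(t - y) * v u| <= rho.
  move=> /v01/andP[v0 v1]; rewrite normrM (ger0_norm v0).
  exact: ler_piMr.
have fact u : 0 <= u <= 1 ->
    f u = u * (1 - y * u) `^ (- s) * (1 - (t - y) * v u) `^ (- s).
  move=> u01; have d := d1 u u01; have := tvr u u01.
  rewrite ler_norml => /andP[_ h].
  rewrite /f -mulrA -powRM; [|lra|by move: ty; rewrite -/rho; lra].
  by congr (_ * _ `^ _); rewrite /v; field; lra.
have bg k : bdd (g k).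
  apply: bdd_unit => u u01; have /andP[p0 p1] := p01 u u01.
  have /andP[v0 v1] := v01 u u01.
  by rewrite /g mulr_ge0 ?exprn_ge0 //= mulr_ile1 ?exprn_ge0 // exprn_ile1.
have bf : bdd f.
  exists (1 - rho)^-1 => u u01; rewrite fact // normrM -[leRHS]mul1r.
  have /andP[p0 p1] := p01 u u01; have := tvr u u01.
  rewrite ler_norml => /andP[_ h].
  rewrite ler_pM // ?ger0_norm // ?powR_ge0 //.
  have rho0 : 0 <= rho by exact: normr_ge0.
  by apply: powRN_le; rewrite ?subr_gt0 ?gerBl ?lerB ?(ltW s0).
have SN N : \sum_(k < N) (bcoef s k * L (g k)) * (t - y) ^+ k =
    L (fun u => \sum_(k < N) bcoef s k * (t - y) ^+ k * g k u).
  rewrite (state_sum L (fun k => bcoef s k * (t - y) ^+ k) g N sL bg).2.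
  by apply: eq_bigr => k _; rewrite mulrAC.
have err N : `|\sum_(k < N.+1) (bcoef s k * L (g k)) * (t - y) ^+ k - L f|
    <= (1 - rho) ^- 2 * (N.+1%:R * rho ^+ N.+1).
  have [bS _] := state_sum L (fun k => bcoef s k * (t - y) ^+ k) g N.+1 sL bg.
  rewrite SN -[_ - _]addrC -mulN1r -state_lin //.
  apply: state_bound => // u u01; rewrite mulN1r addrC fact //.
  rewrite (_ : \sum_(k < N.+1) _ = u * (1 - y * u) `^ (- s) * bsum s N.+1 ((t - y) * v u)).
    have /andP[p0 p1] := p01 u u01.
    rewrite -mulrBr normrM (ger0_norm p0) mulrC -[leRHS]mulr1 ler_pM //.
    by rewrite [leRHS]mulrC; apply: bsum_bound => //; exact: tvr.
  rewrite /bsum mulr_sumr; apply: eq_bigr => k _.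
  by rewrite /g [((t - y) * v u) ^+ k]exprMn; ring.
rewrite -(cvg_shiftS (fun N => \sum_(k < N) _)) -/f /=.
apply: cvg_zero; apply: norm_cvg0.
apply: (@squeeze_cvgr _ _ _ _ (fun=> 0)
   (fun N => (1 - rho) ^- 2 * (N.+1%:R * rho ^+ N.+1))).
- by apply: nearW => N; rewrite normr_ge0 /=; exact: err.
- exact: cvg_cst.
rewrite -(mulr0 ((1 - rho) ^- 2)); apply: cvgMl_tmp.
rewrite (cvg_shiftS (fun N => N%:R * rho ^+ N)); apply: cvg_nat_exprn.
by rewrite normr_ge0 ty.
Qed.

(** * Jensen's inequality with a quadratic defect *)

(* With r = (1 + x t) / (1 + x m), powRN_tangent reduces the bound to
   t / r = m + (t - m) / (1 + x m) - x (t - m)^2 / ((1 + x t) (1 + x m)). *)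
Lemma powR_quadratic_bound {R : realType} (s x m t : R) :
  0 < s <= 1 -> 0 < x -> 0 < m -> 0 <= t <= 1 ->
  t * (1 + x * t) `^ (- s) <= (1 + x * m) `^ (- s) *
    (m + (1 - s + s / (1 + x * m)) * (t - m)
       - s * x / ((1 + x) * (1 + x * m)) * (t - m) ^+ 2).
Proof.
move=> /andP[s0 s1] x0 m0 /andP[t0 t1].
have xm : 0 < 1 + x * m by rewrite addr_gt0 // mulr_gt0.
have xt : 0 < 1 + x * t by rewrite ltr_wpDr // mulr_ge0 // ltW.
have x1 : 0 < 1 + x by lra.
set r := (1 + x * t) / (1 + x * m).
have r0 : 0 < r by rewrite divr_gt0.
have -> : (1 + x * t) `^ (- s) = (1 + x * m) `^ (- s) * r `^ (- s).
  by rewrite -powRM ?ltW // /r [(1 + x * m) * _]mulrC divfK // gt_eqF.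
rewrite mulrCA ler_wpM2l ?powR_ge0 //.
have s01 : 0 <= s <= 1 by rewrite ltW.
apply: le_trans (ler_wpM2l t0 (powRN_tangent r s r0 s01)) _.
have -> : t * (s / r + (1 - s)) =
    m + (1 - s + s / (1 + x * m)) * (t - m)
    - s * x / ((1 + x * t) * (1 + x * m)) * (t - m) ^+ 2.
  by rewrite /r; field; rewrite !gt_eqF.
rewrite lerD2l lerN2 ler_wpM2r ?sqr_ge0 // ler_wpM2l ?mulr_ge0 ?(ltW x0) ?(ltW s0) //.
by rewrite lef_pV2 ?posrE ?mulr_gt0 // ler_pM2r // lerD2l ler_piMr // ltW.
Qed.

(** Under [L] the linear term of [powR_quadratic_bound] cancels because [L id = m], and the
    quadratic one becomes a positive multiple of the variance [L (t^2) - m^2], whence strictness. *)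
Lemma state_jensen {R : realType} (L : (R -> R) -> R) (s x : R) :
  state L -> 0 < s <= 1 -> 0 < x -> 0 < L id ->
  L id ^+ 2 < L (fun t => t ^+ 2) ->
  L (fun t => t * (1 + x * t) `^ (- s)) < L id * (1 + x * L id) `^ (- s).
Proof.
move=> sL s01 x0; set m := L id => m0 var; have /andP[s0 s1] := s01.
have xm : 0 < 1 + x * m by rewrite addr_gt0 // mulr_gt0.
pose A := (1 + x * m) `^ (- s); have A0 : 0 < A by rewrite powR_gt0.
pose al := 1 - s + s / (1 + x * m).
pose ka := s * x / ((1 + x) * (1 + x * m)).
have ka0 : 0 < ka by rewrite !(divr_gt0, mulr_gt0) //; lra.
(* The quadratic majorant expanded in powers of [t], in the shape that [state_lin] consumes. *)
pose Q t := - (A * ka) * t ^+ 2 + (A * (al + 2 * ka * m) * id t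
   + A * (m - al * m - ka * m ^+ 2)).
have b1 : bdd (@id R) by apply: bdd_unit.
have bc (c : R) : bdd (fun=> c) by exact: bdd_cst.
have b2 : bdd (fun t : R => t ^+ 2) by exact: bddX.
have b3 : bdd (fun t : R => A * (al + 2 * ka * m) * id t
   + A * (m - al * m - ka * m ^+ 2)).
  by apply: bddD => //; apply: bddM.
have LQ : L Q = A * m - A * ka * (L (fun t => t ^+ 2) - m ^+ 2).
  by rewrite /Q !state_lin // state_cst // -/m; ring.
have : L (fun t => t * (1 + x * t) `^ (- s)) <= L Q.
  apply: state_le => //.
  - apply: bddM => //; apply: bdd_unit => t /andP[t0 t1]; rewrite powR_ge0 /=.
    rewrite -[leRHS]invr1; apply: powRN_le => //; last by rewrite ltW.
    by rewrite lerDl mulr_ge0 // ltW.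
  - by apply: bddD => //; apply: bddM.
  - move=> t t01; apply: le_trans (powR_quadratic_bound _ _ _ _ s01 x0 m0 t01) _.
    by rewrite -/A -/al -/ka le_eqVlt; apply/orP; left; apply/eqP; rewrite /Q; ring.
rewrite LQ mulrC => /le_lt_trans; apply; rewrite -/A gtrBl.
by apply: mulr_gt0; [exact: mulr_gt0|rewrite subr_gt0].
Qed.

(** * Identification of [m * F] with the functional, and the inequality *)

Theorem theorem4 (R : realType) (q : nat) (hq : (1 <= q)%N)
  (a b : 'I_q -> R) (s : R)
  (hab : forall i, 1 < a i /\ a i < b i)
  (hs : 0 < s /\ s <= 1)
  (F : R -> R) (hF : hyp_continuation s a b F) :
  forall x : R, 0 < x ->
    F (- x) < 1 / ((1 + x * \prod_(i < q) ((a i - 1) / (b i - 1))) `^ s).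
Proof.
move=> x x0; set m := \prod_(i < q) _.
have s01 : 0 < s <= 1 by apply/andP.
have pos i : [/\ 0 < a i, 0 < b i, 0 < a i - 1 & 0 < b i - 1].
  by have [h1 h2] := hab i; split; lra.
have m0 : 0 < m by apply: prodr_gt0 => i _; have [*] := pos i; exact: divr_gt0.
have [i|L sL mom] := @product_state R q (fun i => a i - 1) (fun i => b i - 1).
  by have [h1 h2] := hab i; split; lra.
have momS n : L (fun t => t ^+ n.+1) = m * \prod_(i < q) (poch (a i) n / poch (b i) n).
  rewrite mom -big_split /=; apply: eq_bigr => i _.
  by rewrite !pochSl !subrK invfM mulrACA.
have m1 : L id = m.
  rewrite -[RHS](mulr1 m) -(_ : L (fun t => t ^+ 1) = m * 1) //.
  by rewrite momS big1 // => i _; rewrite !poch0 divr1.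
pose G t := L (fun u => u * (1 - t * u) `^ (- s)).
have Gexp y t := state_powR_expansion L s y t sL s01.
have [Fa Fs] := hF.
(* At [y = 0] the expansion of [G] has coefficients [bcoef s k * L (u ^+ k.+1)], which [momS] turns
   into [m] times those of the hypergeometric series. *)
have FG0 t : `|t| < 1 -> m * F t - G t = 0.
  move=> t1; have h1 := Gexp 0 t (lexx 0); rewrite subr0 in h1.
  have h2 : ((fun N => m * \sum_(k < N) hyp_coef s a b k * t ^+ k) @ \oo
      --> m * F t)%classic by apply: cvgMl_tmp; exact: Fs.
  apply/eqP; rewrite subr_eq0; apply/eqP.
  apply: (cvg_unique (@norm_hausdorff _ _) h2); move: (h1 t1).
  apply: cvg_trans; apply: near_eq_cvg; apply: nearW => N /=.
  rewrite mulr_sumr; apply: eq_bigr => k _; rewrite mulrA; congr (_ * _).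
  rewrite (_ : (fun u => _) = fun u => u ^+ k.+1).
    rewrite momS /hyp_coef /bcoef big_split /= prodfV invfM.
    by ring.
  by apply/funext => u; rewrite mul0r subr0 powR1 mulr1 divr1 exprS.
have FG t : t <= 0 -> m * F t - G t = 0.
  apply: (analytic_zero (fun t => m * F t - G t)) => // y /= y0.
  have [|r [r0 [c hc]]] := Fa y; first by rewrite /=; lra.
  (* The expansion of [G] is valid within distance 1 of every [y <= 0], that of [F] within [r]. *)
  exists (Num.min r 1); split; first by rewrite lt_min r0 ltr01.
  exists (fun k => m * c k - bcoef s k *
       L (fun u => u * (1 - y * u) `^ (- s) * (u / (1 - y * u)) ^+ k)) => u.
  rewrite lt_min => /andP[/hc h1 /(Gexp _ _ y0) h2].
  rewrite (_ : (fun N => _) = (fun N => m * \sum_(k < N) c k * (u - y) ^+ k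
    - \sum_(k < N) (bcoef s k *
       L (fun u => u * (1 - y * u) `^ (- s) * (u / (1 - y * u)) ^+ k)) * (u - y) ^+ k)).
    by apply: cvgB => //; apply: cvgMl_tmp.
  apply/funext => N; rewrite mulr_sumr -sumrB; apply: eq_bigr => k _.
  by rewrite mulrBl mulrA.
rewrite mul1r -powRN -(ltr_pM2l m0).
have /FG/eqP : - x <= 0 by lra.
rewrite subr_eq0 => /eqP ->.
rewrite /G -m1 (_ : (fun u => _) = fun t => t * (1 + x * t) `^ (- s)).
  (* The variance is positive because [L (t^2)] is [m] times the product of the [a i / b i], and
     [(a i - 1) / (b i - 1) < a i / b i]; by [hq] there is a factor to make the product strictly
     larger. *)
  apply: state_jensen => //; rewrite m1 // momS expr2 ltr_pM2l //.
  under [ltRHS]eq_bigr do rewrite !pochS !poch0 !mul1r !addr0.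
  apply: ltr_prod => [|i _]; first by apply/hasP; exists (Ordinal hq); rewrite ?mem_index_enum.
  have [h1 h2] := hab i; have [a0 b0 a1 b1] := pos i.
  rewrite divr_ge0 ?ltW //= ltr_pdivrMr // mulrAC ltr_pdivlMr //; lra.
by apply/funext => u; rewrite mulNr opprK.
Qed.
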